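(* Let $n\ge 1$, let $\theta\in\mathbb{R}$ satisfy $e^{i\theta}\,i^n=-i$, and let real-valued $C^2$ functions $p_1(s),\dots,p_n(s),r(s)$ on an interval $I$ satisfy $$F_\theta(p_1,\dots,p_n)\,\frac{p_j''}{2}=\frac{\partial F_\theta}{\partial p_j}\,(p_j')^2\quad(j=1,\dots,n),\qquad F_\theta(p_1,\dots,p_n)\,r''=-F_{\theta+\frac{\pi}{2}}(p_1,\dots,p_n).$$ Assume that $p_j'(s)>0$ for all $j$, that $F_\theta(p_1,\dots,p_n)>0$, and let $\kappa>0$ be the constant with $\prod_{j=1}^np_j'=\kappa\,(F_\theta)^2$. Introduce $t=\sqrt{\kappa}\,s$, $\xi_j=\sqrt{p_j'(s)}\,x_j$ for $x_j\in\mathbb{R}$, and the complex-valued functions of $t$ $$w_j=i\,\frac{1+ip_j(s)}{\sqrt{p_j'(s)}}\quad(j=1,\dots,n),\qquad \beta=i\,(s+i\,r'(s)).$$ Then the graph of the gradient of $f(x_1,\dots,x_n,s)=\frac12\sum_{j=1}^np_j(s)x_j^2+r(s)$ satisfies $$\Bigl((1+ip_1)x_1,\dots,(1+ip_n)x_n,\;s+i\bigl(\tfrac12\sum_{j=1}^nx_j^2p_j'+r'\bigr)\Bigr)=-i\Bigl(w_1(t)\xi_1,\dots,w_n(t)\xi_n,\;-\tfrac{\xi_1^2+\dots+\xi_n^2}{2}+\beta(t)\Bigr),$$ and $w_1,\dots,w_n,\beta$ satisfy the ODE system $$\frac{dw_j}{dt}=\overline{w_1\cdots w_{j-1}w_{j+1}\cdots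 w_n}\quad(j=1,\dots,n),\qquad \frac{d\beta}{dt}=\overline{w_1\cdots w_n}.$$
   Context: For $\theta\in\mathbb{R}$, $F_\theta(p_1,\dots,p_n)=\operatorname{Re}\bigl(e^{-i\theta}(1+ip_1)\cdots(1+ip_n)\bigr)$. Primes denote $d/ds$. The quantity $\prod_jp_j'/(F_\theta)^2$ is constant along solutions of the system, so $\kappa$ exists. The graph of $\nabla f$ is viewed in $\mathbb{C}^{n+1}$ as the set of points $(x,s)+i\nabla f(x,s)$. The last ODE system is Joyce's evolving-quadrics system, whose solutions give the special Lagrangian submanifolds $\{(w_1(t)\xi_1,\dots,w_n(t)\xi_n,-\frac{\xi_1^2+\dots+\xi_n^2}{2}+\beta(t))\}$ of $\mathbb{C}^{n+1}$. *)

(* Defs.v *)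
(* Finite index sets and iterated operators come from MathComp; the reals, the
   complex numbers and differentiation from Stdlib and Coquelicot. *)
From mathcomp Require Import all_boot.
From Stdlib Require Import Reals.
From Coquelicot Require Import Coquelicot.

Set Implicit Arguments.
Unset Strict Implicit.
Unset Printing Implicit Defensive.

Open Scope R_scope.

(* [is_connected] is Coquelicot's order-convexity; any combination of open,
   closed or infinite ends is allowed. *)
Definition is_interval (D : R -> Prop) : Prop :=
  is_connected D /\ exists a b : R, D a /\ D b /\ a < b.

(* Coquelicot's [is_derive] with the neighbourhood filter restricted to D: the
   usual derivative at interior points of D, the one-sided derivative at an
   endpoint that belongs to D. *)
Definition is_derive_in (V : NormedModule R_AbsRing)
    (D : R -> Prop) (f : R -> V) (s : R) (l : V) : Prop :=
  filterdiff f (within D (locally s)) (fun y : R => scal y l).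

Definition is_C2_on (D : R -> Prop) (f df ddf : R -> R) : Prop :=
  (forall s : R, D s -> is_derive_in (V := R_NormedModule) D f s (df s)) /\
  (forall s : R, D s -> is_derive_in (V := R_NormedModule) D df s (ddf s)) /\
  continuous_on D ddf.

Definition expi (theta : R) : C := (cos theta, sin theta).

Definition Ftheta (n : nat) (theta : R) (p : 'I_n -> R) : R :=
  Re (expi (- theta) * \big[Cmult/RtoC 1]_(j < n) (1 + Ci * p j))%C.

Definition upd (n : nat) (p : 'I_n -> R) (j : 'I_n) (u : R) : 'I_n -> R :=
  fun k => if k == j then u else p k.

Definition partial (n : nat) (F : ('I_n -> R) -> R) (j : 'I_n) (p : 'I_n -> R)
    : R :=
  Derive (fun u : R => F (upd p j u)) (p j).

(* R^(n+1) and C^(n+1), with the last coordinate kept apart. *)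
Definition Rpt (n : nat) : Type := (('I_n -> R) * R)%type.
Definition Cpt (n : nat) : Type := (('I_n -> C) * C)%type.

Definition scaleC (n : nat) (c : C) (z : Cpt n) : Cpt n :=
  (fun j => (c * z.1 j)%C, (c * z.2)%C).

Definition is_gradient (n : nat) (D : R -> Prop) (f : Rpt n -> R)
    (a g : Rpt n) : Prop :=
  (forall j : 'I_n,
     is_derive (V := R_NormedModule)
       (fun u : R => f (upd a.1 j u, a.2)) (a.1 j) (g.1 j)) /\
  is_derive_in (V := R_NormedModule) D (fun u : R => f (a.1, u)) a.2 g.2.

(* The point a + i g of C^(n+1). *)
Definition complex_point (n : nat) (a g : Rpt n) : Cpt n :=
  (fun j => (a.1 j + Ci * g.1 j)%C, (a.2 + Ci * g.2)%C).

Definition quadratic_potential (n : nat) (p : 'I_n -> R -> R) (r : R -> R)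
    (a : Rpt n) : R :=
  1 / 2 * \big[Rplus/0]_(j < n) (p j a.2 * a.1 j ^ 2) + r a.2.

(* The point (w_1 xi_1, ..., w_n xi_n, - (xi_1^2 + ... + xi_n^2) / 2 + beta). *)
Definition quadric_point (n : nat) (w : 'I_n -> C) (beta : C) (xi : 'I_n -> R)
    : Cpt n :=
  (fun j => (w j * xi j)%C,
   (RtoC (- (\big[Rplus/0]_(j < n) xi j ^ 2) / 2)%R + beta)%C).

Definition evolving_quadrics_system (n : nat) (J : R -> Prop)
    (w : 'I_n -> R -> C) (beta : R -> C) : Prop :=
  (forall (j : 'I_n) (t : R), J t ->
     is_derive_in (V := C_R_NormedModule) J (w j) t
       (Cconj (\big[Cmult/RtoC 1]_(k < n | k != j) w k t))) /\
  (forall t : R, J t ->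
     is_derive_in (V := C_R_NormedModule) J beta t
       (Cconj (\big[Cmult/RtoC 1]_(k < n) w k t))).

(* Main.v *)
(* The system determines w_j' up to a positive factor: writing Z for
   e^(-i theta) times the product of the 1 + i p_k over k <> j, both F_theta and
   its j-th partial derivative are real-linear in Z, and the second-order
   equation for p_j collapses to dw_j/ds = - sqrt(p_j') * conj(Z) / F_theta.
   The conservation law turns the product of the sqrt(p_k') into
   sqrt(kappa) * F_theta, so the phase condition on theta identifies dw_j/dt with
   the conjugate of the product of the other w_k.  In the same way
   i F_theta - F_theta r'' = i conj(e^(-i theta) (1 + i p_1) ... (1 + i p_n))
   gives the equation for beta. *)

From HB Require Import structures.
Require Import Defs.
From mathcomp Require Import all_boot.
From Stdlib Require Import Reals Lra Classical FunctionalExtensionality.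
From Coquelicot Require Import Coquelicot.

Open Scope R_scope.

(** * Commutative monoid laws behind the iterated sums and products *)

HB.instance Definition _ := Monoid.isComLaw.Build R 0 Rplus
  (fun x y z => esym (Rplus_assoc x y z)) Rplus_comm Rplus_0_l.
HB.instance Definition _ := Monoid.isComLaw.Build R 1 Rmult
  (fun x y z => esym (Rmult_assoc x y z)) Rmult_comm Rmult_1_l.
HB.instance Definition _ := Monoid.isComLaw.Build C (RtoC 1) Cmult
  Cmult_assoc Cmult_comm Cmult_1_l.

(** * Calculus of derivatives relative to a set of reals *)

Lemma within_locally_proper (D : R -> Prop) (s : R) :
  D s -> ProperFilter (within D (locally s)).
Proof.
move=> Ds; apply: Build_ProperFilter.
by move=> P hP; exists s; exact: (locally_singleton _ _ hP).
Qed.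

Lemma within_locally_filter (D : R -> Prop) (s : R) :
  Filter (within D (locally s)).
Proof. exact: within_filter. Qed.

Lemma within_locally_lim (D : R -> Prop) (s : R) :
  is_filter_lim (within D (locally s)) s.
Proof. by move=> P hP; exact: filter_le_within hP. Qed.

Lemma is_derive_inW (V : NormedModule R_AbsRing) (D : R -> Prop) (f : R -> V)
    (s : R) (l : V) :
  D s -> is_derive f s l -> is_derive_in D f s l.
Proof.
move=> Ds hf.
have FF := within_locally_proper D s Ds.
by apply: (filterdiff_locally _ s) => //; exact: within_locally_lim.
Qed.

Lemma is_derive_in_ext (V : NormedModule R_AbsRing) (D : R -> Prop)
    (f g : R -> V) (s : R) (l : V) :
  D s -> (forall y, D y -> f y = g y) ->
  is_derive_in D f s l -> is_derive_in D g s l.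
Proof.
move=> Ds fg; have FF := within_locally_proper D s Ds.
apply: filterdiff_ext_loc.
  by rewrite /within; apply: filter_forall => y Dy; exact: fg.
(* [filterdiff] also constrains the functions at every limit point of the filter; since the filter
   is proper, [s] is the only one. *)
move=> x hx.
by rewrite -(is_filter_lim_unique s x (within_locally_lim D s) hx); exact: fg.
Qed.

Lemma is_derive_in_continuous (V : NormedModule R_AbsRing) (D : R -> Prop)
    (f : R -> V) (s : R) (l : V) :
  D s -> is_derive_in D f s l ->
  filterlim f (within D (locally s)) (locally (f s)).
Proof.
move=> Ds hf; have FF := within_locally_proper D s Ds.
apply: filterdiff_continuous_aux; last exact: within_locally_lim.
by exists (fun y => scal y l).
Qed.

(** Domination passes to any finer filter. Properness of [F] is what forces each of its limit points
    to be [x], the point at which the estimate along [G] is known. *)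
Lemma filterdiff_finer (U V : NormedModule R_AbsRing)
    (F G : (U -> Prop) -> Prop) (f l : U -> V) (x : U) :
  ProperFilter F -> filter_le F G -> is_filter_lim G x ->
  filterdiff f G l -> filterdiff f F l.
Proof.
move=> FF FG Gx [hl hf]; split=> // y Fy.
have Fx : is_filter_lim F x by move=> P /Gx; exact: FG.
rewrite -(is_filter_lim_unique x y Fx Fy).
by apply: is_domin_le FG; exact: hf.
Qed.

(** The chain rule for [filterdiff] asks for the differential of [g] along the image filter under
    [f]. Continuity of [f] at [s] and the inclusion of [f(D)] in [E] make that filter finer than the
    one of [E] at [f s]. *)
Lemma is_derive_in_comp (V : NormedModule R_AbsRing) (D E : R -> Prop)
    (f : R -> R) (g : R -> V) (s df : R) (dg : V) :
  D s -> (forall y, D y -> E (f y)) ->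
  is_derive_in (V := R_NormedModule) D f s df -> is_derive_in E g (f s) dg ->
  is_derive_in D (fun y => g (f y)) s (scal df dg).
Proof.
move=> Ds fE hf hg; have FF := within_locally_proper D s Ds.
have FFf : ProperFilter (filtermap f (within D (locally s))).
  exact: filtermap_proper_filter.
have hc := is_derive_in_continuous _ _ _ _ _ Ds hf.
have hfg : filterdiff g (filtermap f (within D (locally s)))
    (fun y => scal y dg).
  apply: (filterdiff_finer _ _ _ (within E (locally (f s))) _ _ (f s)) hg;
    last exact: within_locally_lim.
  move=> P hP; have := hc _ hP; rewrite /filtermap /within.
  by apply: filter_imp => y h Dy; exact: (h Dy (fE _ Dy)).
apply: filterdiff_ext_lin (filterdiff_comp _ _ _ _ hf hfg) _ => y.
by rewrite scal_assoc.
Qed.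

Lemma is_derive_in_plus (V : NormedModule R_AbsRing) (D : R -> Prop)
    (f g : R -> V) (s : R) (df dg : V) :
  is_derive_in D f s df -> is_derive_in D g s dg ->
  is_derive_in D (fun y => plus (f y) (g y)) s (plus df dg).
Proof.
move=> hf hg; have FF := within_locally_filter D s.
apply: filterdiff_ext_lin (filterdiff_plus_fct _ _ _ _ hf hg) _ => y.
by rewrite scal_distr_l.
Qed.

Lemma is_derive_in_scal (V : NormedModule R_AbsRing) (D : R -> Prop)
    (f : R -> R) (s df : R) (v : V) :
  is_derive_in (V := R_NormedModule) D f s df ->
  is_derive_in D (fun y => scal (f y) v) s (scal df v).
Proof.
move=> hf; have FF := within_locally_filter D s.
apply: filterdiff_ext_lin (filterdiff_scal_l_fct v _ _ hf) _ => y.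
by rewrite -scal_assoc.
Qed.

Lemma is_derive_in_mult (D : R -> Prop) (f g : R -> R) (s df dg : R) :
  D s -> is_derive_in (V := R_NormedModule) D f s df ->
  is_derive_in (V := R_NormedModule) D g s dg ->
  is_derive_in (V := R_NormedModule) D (fun y => f y * g y) s
    (df * g s + f s * dg).
Proof.
move=> Ds hf hg; have FF := within_locally_proper D s Ds.
have hfg : filterdiff (fun t : R * R => mult t.1 t.2)
    (filtermap (fun y => (f y, g y)) (within D (locally s)))
    (fun t => plus (mult t.1 (g s)) (mult (f s) t.2)).
  apply: (filterdiff_mult (f s, g s)); last exact: Rmult_comm.
  (* The image filter of the pair converges to [(f s, g s)]: a product ball is reached by
     intersecting the continuity conditions of [f] and [g]. *)
  move=> P [eps hP].
  have hcf := is_derive_in_continuous _ _ _ _ _ Ds hf _ (locally_ball (f s) eps).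
  have hcg := is_derive_in_continuous _ _ _ _ _ Ds hg _ (locally_ball (g s) eps).
  rewrite /filtermap in hcf hcg *.
  apply: filter_imp (filter_and _ _ hcf hcg) => y [h1 h2].
  exact: hP.
have h := filterdiff_comp_2 f g
  (fun x y => mult x y) _ _ (fun x y => plus (mult x (g s)) (mult (f s) y))
  hf hg hfg.
apply: filterdiff_ext_lin (h _) _ => y.
rewrite /scal /= /mult /= /plus /=; ring.
Qed.

(** Writing the pair as u (1,0) + v (0,1) reduces the claim to the rules for sums and for multiples
    of a fixed vector. *)
Lemma is_derive_in_pair (D : R -> Prop) (u v : R -> R) (s du dv : R) :
  is_derive_in (V := R_NormedModule) D u s du ->
  is_derive_in (V := R_NormedModule) D v s dv ->
  is_derive_in (V := C_R_NormedModule) D (fun y => (u y, v y) : C) s (du, dv).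
Proof.
move=> hu hv; have FF := within_locally_filter D s.
have E (a b : R) : plus (scal a ((1, 0) : C_R_NormedModule))
    (scal b ((0, 1) : C_R_NormedModule)) = (a, b).
  by rewrite /plus /scal /= /prod_plus /prod_scal /= /plus /scal /= /mult /=;
    congr pair; ring.
have h := is_derive_in_plus _ _ _ _ _ _ _
  (is_derive_in_scal _ _ _ _ _ ((1, 0) : C_R_NormedModule) hu)
  (is_derive_in_scal _ _ _ _ _ ((0, 1) : C_R_NormedModule) hv).
rewrite E in h.
by apply: filterdiff_ext h => y; exact: E.
Qed.

Lemma is_derive_in_opp (D : R -> Prop) (f : R -> R) (s df : R) :
  is_derive_in (V := R_NormedModule) D f s df ->
  is_derive_in (V := R_NormedModule) D (fun y => - f y) s (- df).
Proof.
move=> hf; have FF := within_locally_filter D s.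
apply: filterdiff_ext_lin (filterdiff_opp_fct _ _ hf) _ => y.
by rewrite scal_opp_r.
Qed.

Lemma is_derive_in_sum (J : finType) (D : R -> Prop) (f : J -> R -> R) (s : R)
    (df : J -> R) :
  (forall j, is_derive_in (V := R_NormedModule) D (f j) s (df j)) ->
  is_derive_in (V := R_NormedModule) D (fun y => \big[Rplus/0]_j f j y) s
    (\big[Rplus/0]_j df j).
Proof.
move=> hf; rewrite unlock /reducebig; elim: (index_enum J) => [|j e IH] /=.
  have FF := within_locally_filter D s.
  apply: filterdiff_ext_lin (filterdiff_const 0) _ => y.
  by rewrite scal_zero_r.
exact: (is_derive_in_plus R_NormedModule).
Qed.

(** A nondegenerate interval has points other than [s] arbitrarily close to [s], even when [s] is an
    endpoint, and these determine the derivative. *)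
Lemma is_derive_in_unique (D : R -> Prop) (f : R -> R) (s l1 l2 : R) :
  is_interval D -> D s ->
  is_derive_in (V := R_NormedModule) D f s l1 ->
  is_derive_in (V := R_NormedModule) D f s l2 -> l1 = l2.
Proof.
move=> [Dconv [a [b [Da [Db ab]]]]] Ds hf1 hf2.
have FF := within_locally_filter D s.
have [_ /(_ s (within_locally_lim D s)) h] :=
  filterdiff_minus_fct _ _ _ _ hf1 hf2.
apply: Rminus_diag_uniq; apply: NNPP => ne.
(* With this tolerance the difference of the two expansions yields |l1 - l2| |y - s| <= |l1 - l2| |y
   - s| / 2, which is absurd for y <> s. *)
have e0 : 0 < Rabs (l1 - l2) / 2.
  by have := Rabs_pos_lt _ ne; lra.
have [d hd] := h (mkposreal _ e0).
have [y [Dy [ys yd]]] : exists y, D y /\ y <> s /\ Rabs (y - s) < d.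
  have d0 := cond_pos d.
  (* Step by at most d/2 towards [b] if [s] lies left of it, otherwise towards [a]; order-convexity
     keeps the new point in [D]. *)
  have [sb|bs] := Rlt_le_dec s b.
    exists (Rmin b (s + d / 2)); have := Rmin_glb_lt b (s + d / 2) s.
    move: (Rmin_l b (s + d / 2)) (Rmin_r b (s + d / 2)).
    move: (Rmin b _) => m h1 h2 h3.
    have {}h3 : s < m by apply: h3; lra.
    split; last first.
      by split; [lra | rewrite Rabs_pos_eq; lra].
    by apply: (Dconv s b) => //; lra.
  exists (Rmax a (s - d / 2)); have := Rmax_lub_lt a (s - d / 2) s.
  move: (Rmax_l a (s - d / 2)) (Rmax_r a (s - d / 2)).
  move: (Rmax a _) => m h1 h2 h3.
  have {}h3 : m < s by apply: h3; lra.
  split; last first.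
    by split; [lra | rewrite -Rabs_Ropp Rabs_pos_eq; lra].
  by apply: (Dconv a s) => //; lra.
have := hd y yd Dy.
rewrite /norm /= /minus /scal /plus /opp /= /mult /= /abs /=.
have -> : f y + - f y + - (f s + - f s) + - ((y + - s) * l1 + - ((y + - s) * l2))
  = - ((l1 - l2) * (y - s)) by ring.
rewrite Rabs_Ropp Rabs_mult.
have : 0 < Rabs (l1 - l2) by lra.
have : 0 < Rabs (y - s) by apply: Rabs_pos_lt; lra.
rewrite /Rminus; move: (Rabs _) (Rabs _) => u v hu hv.
have := Rmult_lt_0_compat _ _ hu hv; lra.
Qed.

(** Passage from s to t = c s, used with c = sqrt(kappa). On the rescaled interval [g] agrees with t
    |-> f(t / c), so the chain rule applies; nothing is assumed about [g] elsewhere. *)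
Lemma is_derive_in_rescale (V : NormedModule R_AbsRing) (D : R -> Prop) (c : R)
    (f g : R -> V) (s : R) (l : V) :
  c <> 0 -> D s -> (forall y, D y -> g (c * y) = f y) ->
  is_derive_in D f s l ->
  is_derive_in (fun t => exists y, D y /\ t = c * y) g (c * s) (scal (/ c) l).
Proof.
move=> c0 Ds gf hf.
have Ec y : / c * (c * y) = y by field.
have Js : exists y, D y /\ c * s = c * y by exists s.
apply: (is_derive_in_ext _ _ (fun t => f (/ c * t))) => //.
  by move=> _ [y [Dy ->]]; rewrite Ec gf.
apply: (is_derive_in_comp _ _ D (fun t => / c * t)) => //.
- by move=> _ [y [Dy ->]]; rewrite Ec.
- apply: is_derive_inW => //; auto_derive => //; ring.
- by rewrite Ec.
Qed.

(** * Algebra of F_theta and of finite products *)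

Lemma Ftheta_split (n : nat) (theta : R) (p : 'I_n -> R) (j : 'I_n) :
  let Z := (expi (- theta)
    * \big[Cmult/RtoC 1]_(k < n | k != j) (1 + Ci * p k))%C in
  Ftheta theta p = Re Z - p j * Im Z.
Proof.
rewrite /Ftheta (bigD1 j) //=.
case: (\big[Cmult/RtoC 1]_(k < n | k != j) _)%C => c d.
rewrite /Re /Im /=; ring.
Qed.

(** The product over k <> j does not involve p_j, so by [Ftheta_split] F_theta is affine in p_j, and
    the derivative is its slope. *)
Lemma partial_Ftheta (n : nat) (theta : R) (p : 'I_n -> R) (j : 'I_n) :
  partial (Ftheta theta) j p =
  - Im (expi (- theta)
    * \big[Cmult/RtoC 1]_(k < n | k != j) (1 + Ci * p k))%C.
Proof.
set Z := Cmult _ _; apply: is_derive_unique.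
apply: (is_derive_ext (fun u => Re Z - u * Im Z)).
  move=> u; rewrite (Ftheta_split _ _ _ j) /upd eqxx.
  suff -> : \big[Cmult/RtoC 1]_(k < n | k != j)
    (1 + Ci * (if k == j then u else p k))%C =
    \big[Cmult/RtoC 1]_(k < n | k != j) (1 + Ci * p k)%C by [].
  by apply: eq_bigr => k /negbTE ->.
by move: (Re Z) (Im Z) => a b; auto_derive => //; ring.
Qed.

(** The shift of theta contributes a factor -i, and Re(-i z) = Im z. *)
Lemma Ftheta_addPi2 (n : nat) (theta : R) (p : 'I_n -> R) :
  Ftheta (theta + PI / 2) p =
  Im (expi (- theta) * \big[Cmult/RtoC 1]_(j < n) (1 + Ci * p j))%C.
Proof.
rewrite /Ftheta /expi !cos_neg !sin_neg cos_plus sin_plus cos_PI2 sin_PI2.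
by case: (\big[_/_]_(j < n) _) => [c d]; rewrite /Re /Im /=; ring.
Qed.

Lemma expi_neg_mul (theta : R) : (expi (- theta) * expi theta)%C = 1%C.
Proof.
have := sin2_cos2 theta; rewrite /expi /Cmult /RtoC cos_neg sin_neg /Rsqr /= => h.
by congr pair; [rewrite -h; ring | ring].
Qed.

Lemma bigRmult_gt0 (J : finType) (f : J -> R) :
  (forall j, 0 < f j) -> 0 < \big[Rmult/1]_j f j.
Proof.
move=> f0; apply: (big_ind (fun x => 0 < x)) => //; first exact: Rlt_0_1.
exact: Rmult_lt_0_compat.
Qed.

Lemma bigRmult_sqrt (J : finType) (f : J -> R) :
  (forall j, 0 < f j) ->
  \big[Rmult/1]_j sqrt (f j) = sqrt (\big[Rmult/1]_j f j).
Proof.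
move=> f0.
(* Nonnegativity of the partial products is carried through the induction because multiplicativity
   of [sqrt] needs it. *)
suff [] : \big[Rmult/1]_j sqrt (f j) = sqrt (\big[Rmult/1]_j f j) /\
  0 <= \big[Rmult/1]_j f j by [].
apply: (big_ind2 (fun x y => x = sqrt y /\ 0 <= y)).
- by rewrite sqrt_1; split=> //; lra.
- move=> x1 x2 y1 y2 [-> h1] [-> h2]; split; first by rewrite sqrt_mult.
  exact: Rmult_le_pos.
- by move=> j _; split=> //; have := f0 j; lra.
Qed.

Lemma RtoC_neq0 (x : R) : x <> 0 -> RtoC x <> RtoC 0.
Proof. by move=> x0 /RtoC_inj. Qed.

Lemma Ci_neq0 : Ci <> RtoC 0.
Proof. by case=> /R1_neq_R0. Qed.

Lemma one_plus_Ci_neq0 (x : R) : (1 + Ci * x)%C <> RtoC 0.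
Proof. by case=> h _; move: h; rewrite /=; lra. Qed.

Lemma bigCmult_div (n : nat) (c : C) (a : 'I_n -> C) (b : 'I_n -> R) :
  (forall j, 0 < b j) ->
  \big[Cmult/RtoC 1]_(j < n) (c * (a j / b j))%C =
  (c ^ n * \big[Cmult/RtoC 1]_(j < n) a j
    / RtoC (\big[Rmult/1%R]_(j < n) b j))%C.
Proof.
move=> b0; rewrite /Cdiv !big_split big_const_ord /= -Cmult_assoc; congr Cmult.
  by elim: n {a b b0} => //= n ->.
congr Cmult.
rewrite -RtoC_inv; last by apply: Rgt_not_eq; exact: bigRmult_gt0.
rewrite (big_endo _ Rinv_mult Rinv_1) (big_morph RtoC RtoC_mult (erefl _)).
apply: eq_bigr => j _; rewrite RtoC_inv //; exact: Rgt_not_eq.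
Qed.

(** * Products and derivatives of the functions w_j *)

Section Frame.

Context (n : nat) (theta kappa : R) (p q : 'I_n -> R).
Hypothesis htheta : (expi theta * Ci ^ n)%C = (- Ci)%C.
Hypothesis kappa_gt0 : 0 < kappa.
Hypothesis q_gt0 : forall j, 0 < q j.
Hypothesis F_gt0 : 0 < Ftheta theta p.
Hypothesis hkappa : \big[Rmult/1]_(j < n) q j = kappa * Ftheta theta p ^ 2.

(** The value of w_j at a fixed s, with [p] and [q] standing for the values of the p_j and the p_j';
    the product formulas are then pure algebra. *)
Let frame (j : 'I_n) : C := (Ci * ((1 + Ci * p j) / sqrt (q j)))%C.

(** The conservation law evaluates the product of the sqrt(q_j) as sqrt(kappa) F_theta, and the
    phase condition multiplied by e^(-i theta) gives i^n = -i e^(-i theta). *)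
Lemma frame_prod :
  \big[Cmult/RtoC 1]_(j < n) frame j =
  (- Ci * expi (- theta) * \big[Cmult/RtoC 1]_(j < n) (1 + Ci * p j)
    / RtoC (sqrt kappa * Ftheta theta p))%C.
Proof.
rewrite bigCmult_div; last by move=> j; exact: sqrt_lt_R0.
rewrite bigRmult_sqrt // hkappa sqrt_mult; [|lra|nra].
rewrite sqrt_pow2; last lra.
suff -> : (Ci ^ n = - Ci * expi (- theta))%C by [].
by rewrite -htheta -Cmult_assoc [(Ci ^ n * _)%C]Cmult_comm Cmult_assoc
  [(expi theta * _)%C]Cmult_comm expi_neg_mul Cmult_1_l.
Qed.

(** Divide [frame_prod] by the j-th factor, which is nonzero because 1 + i p_j has real part 1. The
    factor 1 + i p_j cancels, -i / i leaves the sign, and sqrt(q_j) moves to the numerator. *)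
Lemma frame_prod_except (j : 'I_n) :
  \big[Cmult/RtoC 1]_(k < n | k != j) frame k =
  (- (expi (- theta) * \big[Cmult/RtoC 1]_(k < n | k != j) (1 + Ci * p k)
    * RtoC (sqrt (q j) / (sqrt kappa * Ftheta theta p))))%C.
Proof.
have sk := sqrt_lt_R0 _ kappa_gt0; have sq := sqrt_lt_R0 _ (q_gt0 j).
have d0 : sqrt kappa * Ftheta theta p <> 0.
  by apply: Rgt_not_eq; exact: Rmult_lt_0_compat.
have := frame_prod; rewrite (bigD1 j) //= [in RHS](bigD1 j) //= {1}/frame.
move: (\big[_/_]_(k < n | _) frame k) => Q.
move: (\big[_/_]_(k < n | _) _)%C => P.
rewrite RtoC_div //; move: (RtoC_neq0 _ d0).
have : RtoC (sqrt (q j)) <> RtoC 0 by apply: RtoC_neq0; lra.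
have := one_plus_Ci_neq0 (p j); have := Ci_neq0.
move: Ci (RtoC (sqrt (q j))) (RtoC (_ * _)) (1 + _)%C (expi _) => i t d a e.
move=> i0 a0 t0 dn0 h.
have -> : Q = (i * (a / t) * Q * (t / (i * a)))%C by field.
rewrite h; field; tauto.
Qed.

End Frame.

(** Here a + i b plays the role of Z, and the derivative is - sqrt(p') conj(a + i b) / F. The
    function has real part - p / sqrt(p') and imaginary part 1 / sqrt(p'); the equation for p''
    gives the derivative of the latter, and F + p b = a simplifies that of the former. *)
Lemma is_derive_in_frame (D : R -> Prop) (p p' : R -> R) (s p'' F a b : R) :
  D s -> (forall y, D y -> 0 < p' y) ->
  is_derive_in (V := R_NormedModule) D p s (p' s) ->
  is_derive_in (V := R_NormedModule) D p' s p'' ->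
  0 < F -> F = a - p s * b -> F * (p'' / 2) = - b * p' s ^ 2 ->
  is_derive_in (V := C_R_NormedModule) D
    (fun y => Ci * ((1 + Ci * p y) / sqrt (p' y)))%C s
    (- (a * sqrt (p' s) / F), b * sqrt (p' s) / F).
Proof.
move=> Ds p'0 hp hp' F0 Fab hF.
have sq := sqrt_lt_R0 _ (p'0 _ Ds).
have sqq : sqrt (p' s) * sqrt (p' s) = p' s.
  by apply: sqrt_sqrt; have := p'0 _ Ds; lra.
apply: (is_derive_in_ext C_R_NormedModule D
  (fun y => (- p y * / sqrt (p' y), / sqrt (p' y)))) => //.
  move=> y /p'0 /sqrt_lt_R0 h.
  rewrite /Cdiv -RtoC_inv; last lra.
  by rewrite /Cmult /Cplus /RtoC /Ci /=; congr pair; ring.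
have hv : is_derive_in (V := R_NormedModule) D (fun y => / sqrt (p' y)) s
    (b * sqrt (p' s) / F).
  (* The outer function is differentiable in the ordinary sense at the positive number [p' s], so
     the whole line can serve as its domain. *)
  have hg : is_derive_in (V := R_NormedModule) (fun=> True)
      (fun y => / sqrt y) (p' s) (- / (2 * (sqrt (p' s)) ^ 3)).
    apply: is_derive_inW => //; have := p'0 _ Ds => h.
    by auto_derive; [split=> //; lra | field; lra].
  have := is_derive_in_comp _ _ _ _ _ _ _ _ Ds (fun _ _ => Logic.I) hp' hg.
  suff -> : scal p'' (- / (2 * sqrt (p' s) ^ 3)) = b * sqrt (p' s) / F by [].
  rewrite /scal /= /mult /=.
  (* The second-order equation solved for p'', with p' written as a square so that [field] can
     cancel powers of its root. *)
  have -> : p'' = - 2 * b * (sqrt (p' s) * sqrt (p' s)) ^ 2 / F.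
    by rewrite sqq; apply: (Rmult_eq_reg_l F); [field_simplify; lra | lra].
  by field; lra.
apply: is_derive_in_pair => //.
have := is_derive_in_mult _ _ _ _ _ _ Ds (is_derive_in_opp _ _ _ _ hp) hv.
suff -> : - p' s * / sqrt (p' s) + - p s * (b * sqrt (p' s) / F) =
  - (a * sqrt (p' s) / F) by [].
rewrite -{1}sqq; have -> : a = F + p s * b by lra.
by field; lra.
Qed.

(** * The gradient of the quadratic potential *)

Lemma is_gradient_quadratic_potential (n : nat) (D : R -> Prop)
    (p p' : 'I_n -> R -> R) (r r' : R -> R) (x : 'I_n -> R) (s : R) :
  (forall j, is_derive_in (V := R_NormedModule) D (p j) s (p' j s)) ->
  is_derive_in (V := R_NormedModule) D r s (r' s) ->
  is_gradient D (quadratic_potential p r) (x, s)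
    (fun j => p j s * x j,
     1 / 2 * \big[Rplus/0]_(j < n) (x j ^ 2 * p' j s) + r' s).
Proof.
move=> hp hr; split=> [j|] /=.
  apply: (is_derive_ext (fun u => 1 / 2 * (p j s * u ^ 2 +
      \big[Rplus/0]_(k < n | k != j) (p k s * x k ^ 2)) + r s)).
    move=> u; rewrite /quadratic_potential [in RHS](bigD1 j) //= /upd eqxx.
    congr (_ * (_ + _) + _); apply: eq_bigr => k /negbTE -> //.
  by move: (\big[_/_]_(k < n | _) _) => S; auto_derive => //; field.
have hs : is_derive_in (V := R_NormedModule) D
    (fun u => \big[Rplus/0]_(j < n) (p j u * x j ^ 2)) s
    (\big[Rplus/0]_(j < n) (x j ^ 2 * p' j s)).
  apply: is_derive_in_sum => j.
  rewrite Rmult_comm; exact: (is_derive_in_scal R_NormedModule).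
have := is_derive_in_plus _ _ _ _ _ _ _
  (is_derive_in_scal R_NormedModule _ _ _ _ (1 / 2) hs) hr.
rewrite /scal /plus /= /mult /= [_ * (1 / 2)]Rmult_comm.
have FF := within_locally_filter D s.
apply: filterdiff_ext => u; rewrite /quadratic_potential /=.
by rewrite [_ * (1 / 2)]Rmult_comm.
Qed.

(** The x-components are ordinary derivatives; the s-component may be one-sided, and its uniqueness
    rests on the interval being nondegenerate. *)
Lemma is_gradient_unique (n : nat) (D : R -> Prop) (f : Rpt n -> R)
    (a g h : Rpt n) :
  is_interval D -> D a.2 -> is_gradient D f a g -> is_gradient D f a h -> g = h.
Proof.
move=> hD Da [g1 g2] [h1 h2]; rewrite (surjective_pairing g) (surjective_pairing h).
congr pair; last exact: is_derive_in_unique h2.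
apply: functional_extensionality => j.
by rewrite -(is_derive_unique _ _ _ (g1 j)) -(is_derive_unique _ _ _ (h1 j)).
Qed.

Theorem mainTheorem7 (n : nat) (hn : (1 <= n)%nat)
    (theta : R) (htheta : (expi theta * Ci ^ n)%C = (- Ci)%C)
    (I : R -> Prop) (hI : is_interval I)
    (p p' p'' : 'I_n -> R -> R) (r r' r'' : R -> R)
    (hp : forall j : 'I_n, is_C2_on I (p j) (p' j) (p'' j))
    (hr : is_C2_on I r r' r'')
    (hode_p : forall (j : 'I_n) (s : R), I s ->
       Ftheta theta (fun k => p k s) * (p'' j s / 2)
       = partial (Ftheta theta) j (fun k => p k s) * p' j s ^ 2)
    (hode_r : forall s : R, I s ->
       Ftheta theta (fun k => p k s) * r'' s
       = - Ftheta (theta + PI / 2) (fun k => p k s))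
    (hp'_pos : forall (j : 'I_n) (s : R), I s -> 0 < p' j s)
    (hF_pos : forall s : R, I s -> 0 < Ftheta theta (fun k => p k s))
    (kappa : R) (hkappa_pos : 0 < kappa)
    (hkappa : forall s : R, I s ->
       \big[Rmult/1]_(j < n) p' j s
       = kappa * Ftheta theta (fun k => p k s) ^ 2)
    (w : 'I_n -> R -> C) (beta : R -> C)
    (hw : forall (j : 'I_n) (s : R), I s ->
       w j (sqrt kappa * s) = (Ci * ((1 + Ci * p j s) / sqrt (p' j s)))%C)
    (hbeta : forall s : R, I s ->
       beta (sqrt kappa * s) = (Ci * (s + Ci * r' s))%C) :
  (forall (x : 'I_n -> R) (s : R), I s ->
     exists g : Rpt n,
       unique (is_gradient I (quadratic_potential p r) (x, s)) g /\
       complex_point (x, s) g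
       = (fun j => ((1 + Ci * p j s) * x j)%C,
          (s + Ci * RtoC (1 / 2 * \big[Rplus/0]_(j < n) (x j ^ 2 * p' j s)
                          + r' s)%R)%C) /\
       (fun j => ((1 + Ci * p j s) * x j)%C,
        (s + Ci * RtoC (1 / 2 * \big[Rplus/0]_(j < n) (x j ^ 2 * p' j s)
                        + r' s)%R)%C)
       = scaleC (- Ci)%C
           (quadric_point (fun j => w j (sqrt kappa * s))
              (beta (sqrt kappa * s))
              (fun j => sqrt (p' j s) * x j))) /\
  evolving_quadrics_system
    (fun t : R => exists s : R, I s /\ t = sqrt kappa * s) w beta.
Proof.
have sk := sqrt_lt_R0 _ hkappa_pos.
split.
  move=> x s Is.
  have hg := is_gradient_quadratic_potential n I p p' r r' x s
    (fun j => (hp j).1 s Is) (hr.1 s Is).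
  eexists; split; [split; [exact: hg|] | split].
  - by move=> g'; apply: is_gradient_unique.
  - rewrite /complex_point /=; congr pair.
    apply: functional_extensionality => j.
    by rewrite /Cmult /Cplus /RtoC /Ci /=; congr pair; ring.
  rewrite /scaleC /quadric_point /=; congr pair.
    apply: functional_extensionality => j; rewrite hw //.
    have sq := sqrt_lt_R0 _ (hp'_pos j _ Is).
    rewrite /Cdiv -RtoC_inv; last lra.
    by rewrite /Cmult /Cplus /RtoC /Ci /=; congr pair; field; lra.
  rewrite hbeta //.
  (* Since xi_j^2 = p_j' x_j^2, multiplying the last coordinate by -i turns - sum xi_j^2 / 2 into i
     sum x_j^2 p_j' / 2 and beta into s + i r'. *)
  suff -> : \big[Rplus/0]_(j < n) (sqrt (p' j s) * x j) ^ 2 =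
      \big[Rplus/0]_(j < n) (x j ^ 2 * p' j s).
    by rewrite /Cmult /Cplus /Copp /RtoC /Ci /=; congr pair; field.
  apply: eq_bigr => j _; have := hp'_pos j _ Is => h.
  by rewrite Rpow_mult_distr pow2_sqrt; [ring | lra].
split=> [j|] t [s [Is ->]]; have F0 := hF_pos s Is; have hk := hkappa s Is.
- have -> : \big[Cmult/RtoC 1]_(k < n | k != j) w k (sqrt kappa * s) =
      \big[Cmult/RtoC 1]_(k < n | k != j)
        (Ci * ((1 + Ci * p k s) / sqrt (p' k s)))%C.
    by apply: eq_bigr => k _; exact: hw.
  rewrite (frame_prod_except n theta kappa (p^~ s) (p'^~ s)) //; last first.
    by move=> k; exact: hp'_pos.
  have Fab := Ftheta_split n theta (p^~ s) j.
  have := hode_p j s Is; rewrite partial_Ftheta => hF.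
  have hd := is_derive_in_frame _ _ _ _ _ _ _ _ Is (hp'_pos j)
    ((hp j).1 s Is) ((hp j).2.1 s Is) F0 Fab hF.
  have := is_derive_in_rescale C_R_NormedModule _ _ _ _ _ _
    (Rgt_not_eq _ _ sk) Is (hw j) hd.
  (* It remains to compare values: both are - sqrt(p_j') conj(Z) / (sqrt(kappa) F_theta), with Z the
     phase times the product over k <> j. *)
  move=> hd'; apply: (eq_ind _ (fun l => is_derive_in _ _ _ l) hd').
  move: F0 (Cmult (expi _) _) => F0 [a b].
  rewrite /Cconj /Cmult /Copp /RtoC /scal /= /prod_scal /scal /= /mult /=.
  by congr pair; field; lra.
- have -> : \big[Cmult/RtoC 1]_(k < n) w k (sqrt kappa * s) =
      \big[Cmult/RtoC 1]_(k < n) (Ci * ((1 + Ci * p k s) / sqrt (p' k s)))%C.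
    by apply: eq_bigr => k _; exact: hw.
  rewrite (frame_prod n theta kappa (p^~ s) (p'^~ s)) //; last first.
    by move=> k; exact: hp'_pos.
  have hd : is_derive_in (V := C_R_NormedModule) I
      (fun y => Ci * (y + Ci * r' y))%C s (- r'' s, 1).
    apply: (is_derive_in_ext C_R_NormedModule I (fun y => (- r' y, y))) => //.
      by move=> y _; rewrite /Cmult /Cplus /RtoC /Ci /=; congr pair; ring.
    apply: is_derive_in_pair.
      exact: (is_derive_in_opp _ _ _ _ (hr.2.1 s Is)).
    by apply: is_derive_inW => //; exact: is_derive_id.
  have := is_derive_in_rescale C_R_NormedModule _ _ _ _ _ _
    (Rgt_not_eq _ _ sk) Is hbeta hd.
  move=> hd'; apply: (eq_ind _ (fun l => is_derive_in _ _ _ l) hd').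
  have := hode_r s Is; rewrite Ftheta_addPi2.
  move: F0; rewrite -[(- Ci * _ * _)%C]Cmult_assoc /Ftheta.
  move: (Cmult (expi _) _) => [a b]; rewrite /Re /Im /= => a0 hab.
  have d0 : sqrt kappa * a <> 0.
    by apply: Rgt_not_eq; exact: Rmult_lt_0_compat.
  (* With a + i b the phase times the full product, a is F_theta and b is F_(theta + pi/2), so the
     equation for r'' gives b. Both sides then become (- r'' + i) / sqrt(kappa). *)
  have -> : b = - (a * r'' s) by lra.
  rewrite /Cdiv -RtoC_inv // /Cconj /Cmult /Copp /RtoC /Ci /scal /=.
  rewrite /prod_scal /scal /= /mult /=.
  by congr pair; field; lra.
Qed.
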